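(* Let $\mathcal T_1=(S_1,\Sigma_1,\kappa_1)$ be a stochastic transition system and $\mathcal T_2=(S_2,2^{S_2},\kappa_2)$ a denumerable Markov chain which is an $\alpha$-abstraction of $\mathcal T_1$, for a measurable $\alpha:S_1\to S_2$. Let $\mathcal B=\{\alpha^{-1}(B)\mid B\subseteq S_2\}$. Then: (a) if $\mathcal T_2$ is a finite Markov chain and a sound $\alpha$-abstraction of $\mathcal T_1$, then $\mathcal T_2$ has a finite attractor and is a sound $\alpha$-abstraction of $\mathcal T_1$; (b) if $\mathcal T_2$ has a finite attractor and is a sound $\alpha$-abstraction of $\mathcal T_1$, then $\mathcal T_1$ is strongly decisive w.r.t. $\mathcal B$; (c) $\mathcal T_1$ is decisive w.r.t. $\mathcal B$ $\iff$ $\mathcal T_1$ is strongly decisive w.r.t. $\mathcal B$ $\iff$ $\mathcal T_1$ is persistently decisive w.r.t. $\mathcal B$; (d) if $\mathcal T_1$ is strongly decisive w.r.t. $\mathcal B$, then $\mathcal T_1$ is fair w.r.t. $\mathcal B$.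
   Context: A stochastic transition system (STS) is $\mathcal T=(S,\Sigma,\kappa)$ where $(S,\Sigma)$ is a measurable space and $\kappa:S\times\Sigma\to[0,1]$ is a Markov kernel. It is a denumerable Markov chain (DMC) if $S$ is at most countable and $\Sigma=2^S$; a finite Markov chain if moreover $S$ is finite. $\mathrm{Dist}(S)$ is the set of probability measures on $(S,\Sigma)$; $\mathrm{Dist}(B)$ those with $\mu(B)=1$; $\delta_s$ is the Dirac measure. For $\mu\in\mathrm{Dist}(S)$, $\mathrm{Prob}^{\mathcal T}_\mu$ is the law on infinite paths $s_0s_1\dots\in S^\omega$ (cylinder $\sigma$-algebra) of the Markov chain with initial distribution $\mu$ and kernel $\kappa$. Events: $\mathbf F B$: $\exists i\ge0,\ s_i\in B$; $\mathbf F_{\ge p}B$: $\exists i\ge p,\ s_i\in B$; $\mathbf G\mathbf F B$: $s_i\in B$ for infinitely many $i$. Avoid-set: $\widetilde B=\{s\in S\mid\mathrm{Prob}^{\mathcal T}_{\delta_s}(\mathbf F B)=0\}$. $B\in\Sigma$ is an attractor for $\mathcal T$ if $\mathrm{Prob}^{\mathcal T}_\mu(\mathbf F B)=1$ for every $\mu\in\mathrm{Dist}(S)$. $\mathcal T$ is decisive (resp. strongly decisive, persistently decisive) w.r.t. $\mathcal B\subseteq\Sigma$ if for every $B\in\mathcal B$ and every $\mu\in\mathrm{Dist}(S)$: $\mathrm{Prob}^{\mathcal T}_\mu(\mathbf F B\vee\mathbf F\widetilde B)=1$ (resp. $\mathrm{Prob}^{\mathcal T}_\mu(\mathbf G\mathbf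 F B\vee\mathbf F\widetilde B)=1$; for all $p\ge0$, $\mathrm{Prob}^{\mathcal T}_\mu(\mathbf F_{\ge p}B\vee\mathbf F_{\ge p}\widetilde B)=1$). $\mathcal T$ is fair w.r.t. $\mathcal B$ if for every $B\in\mathcal B$, $\mu\in\mathrm{Dist}(S)$, and every $B'\in\Sigma$ such that $\mathrm{Prob}^{\mathcal T}_{\mu'}(s_0\in B',s_1\in B)>0$ for all $\mu'\in\mathrm{Dist}(B')$: $\mathrm{Prob}^{\mathcal T}_\mu(\mathbf G\mathbf F B')>0$ implies $\mathrm{Prob}^{\mathcal T}_\mu(\mathbf G\mathbf F B\mid\mathbf G\mathbf F B')=1$. $\Omega_{\mathcal T}(\mu)(A)=\int_S\kappa(s,A)\,\mu(\mathrm ds)$; $\alpha_\#(\mu)(M)=\mu(\alpha^{-1}(M))$. $\mathcal T_2$ is an $\alpha$-abstraction of $\mathcal T_1$ if for every $\mu\in\mathrm{Dist}(S_1)$ the measures $\alpha_\#(\Omega_{\mathcal T_1}(\mu))$ and $\Omega_{\mathcal T_2}(\alpha_\#(\mu))$ have the same null sets. It is sound if for every $\mu\in\mathrm{Dist}(S_1)$ and $B\in\Sigma_2$: $\mathrm{Prob}^{\mathcal T_2}_{\alpha_\#(\mu)}(\mathbf F B)=1$ implies $\mathrm{Prob}^{\mathcal T_1}_\mu(\mathbf F\alpha^{-1}(B))=1$. *)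

(* Defs.v *)
From HB Require Import structures.
From mathcomp Require Import all_boot all_order all_algebra.
From mathcomp Require Import all_classical all_reals all_analysis.
From mathcomp Require Import measurable_realfun.

(* A stochastic transition system on a measurable space S is a probability
   kernel kappa : R.-pker S ~> S, and Dist(S) is probability S R. A
   measurableType is inhabited, so state spaces are nonempty. *)

Set Implicit Arguments.
Unset Strict Implicit.
Unset Printing Implicit Defensive.
Import Order.TTheory GRing.Theory Num.Theory.
Import numFieldNormedType.Exports.
Local Open Scope classical_set_scope.
Local Open Scope ring_scope.
Local Open Scope ereal_scope.

(* Infinite paths w = w 0, w 1, ... with the sigma-algebra generated by the
   coordinate maps, i.e. the cylinder sigma-algebra. *)
Definition coordinate_sets d (S : measurableType d) : set (set (nat -> S)) :=
  [set C | exists i (A : set S), measurable A /\ C = [set w | A (w i)]].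

Notation paths S := (g_sigma_algebraType (@coordinate_sets _ S)).

Definition cylinder d (S : measurableType d) (n : nat) (A : nat -> set S) :
    set (paths S) :=
  [set w | forall i, (i <= n)%N -> A i (w i)].

(* Probability that the chain started in s visits A 0, ..., A n at times
   0, ..., n. *)
Fixpoint cylinder_prob d (S : measurableType d) (R : realType)
    (kappa : R.-pker S ~> S) (n : nat) (A : nat -> set S) (s : S) : \bar R :=
  (\1_(A 0%N) s)%:E *
  (if n is m.+1
   then \int[kappa s]_t cylinder_prob kappa m (fun i => A i.+1) t else 1).

Definition is_path_law d (S : measurableType d) (R : realType)
    (kappa : R.-pker S ~> S) (mu : probability S R)
    (P : probability (paths S) R) :=
  forall n (A : nat -> set S), (forall i, measurable (A i)) ->
    P (cylinder n A) = \int[mu]_s cylinder_prob kappa n A s.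

(* Existence of the path law (Ionescu-Tulcea extension): horizon n s is the law
   of the chain started in s and frozen after n steps; on a set depending on
   coordinates 0, ..., n it agrees with horizon m s for every m >= n, which
   yields a premeasure on the algebra of such sets. *)
Module PathLaw.

Section path_kernels.
Context d (S : measurableType d) (R : realType).

Definition scons (s : S) (w : paths S) : paths S :=
  fun n => if n is m.+1 then w m else s.

Lemma measurable_coord i : measurable_fun [set: paths S] (fun w => w i).
Proof.
move=> _ A mA; rewrite setTI; apply: sub_sigma_algebra.
by exists i, A; split.
Qed.

Lemma measurable_paths d' (T : measurableType d') (f : T -> paths S) :
  (forall i, measurable_fun setT (fun t => f t i)) -> measurable_fun setT f.
Proof.
move=> mf; apply: measurability; first by reflexivity.
move=> _ [_ [i [A [mA ->]]] <-]; exact: mf.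
Qed.

Lemma measurable_scons2 :
  measurable_fun setT (fun x : S * paths S => scons x.1 x.2).
Proof.
apply: measurable_paths => -[|i] /=; first exact: measurable_fst.
by apply: (measurableT_comp (measurable_coord i)); exact: measurable_snd.
Qed.

Lemma measurable_scons s : measurable_fun setT (scons s).
Proof.
apply: measurable_paths => -[|i] /=; first exact: measurable_cst.
exact: measurable_coord.
Qed.

Lemma measurable_scons_preimage s A : measurable A -> measurable (scons s @^-1` A).
Proof. by move=> mA; rewrite -[X in measurable X]setTI; exact: measurable_scons. Qed.

Section glue.
Variable l : R.-spker S ~> paths S.

Definition glue (s : S) (A : set (paths S)) : \bar R := l s (scons s @^-1` A).

Let glue0 s : glue s set0 = 0.
Proof. by rewrite /glue preimage_set0 measure0. Qed.

Let glue_ge0 s A : 0 <= glue s A.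
Proof. exact: measure_ge0. Qed.

Let glue_sigma_additive s : semi_sigma_additive (glue s).
Proof.
move=> F mF tF mUF; rewrite /glue preimage_bigcup.
apply: measure_semi_sigma_additive.
- by move=> n; exact: measurable_scons_preimage.
- apply/trivIsetP => /= i j _ _ ij; rewrite -preimage_setI.
  by move/trivIsetP : tF => /(_ _ _ _ _ ij) ->//; rewrite preimage_set0.
- by rewrite -preimage_bigcup; exact: measurable_scons_preimage.
Qed.

HB.instance Definition _ s := isMeasure.Build _ _ _ (glue s)
  (glue0 s) (glue_ge0 s) (@glue_sigma_additive s).

Definition mglue := (glue : S -> {measure set (paths S) -> \bar R}).

Let measurable_mglue U : measurable U -> measurable_fun setT (mglue ^~ U).
Proof.
move=> mU.
pose V := (fun x : S * paths S => scons x.1 x.2) @^-1` U.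
rewrite [X in measurable_fun _ X](_ : _ = (fun s => l s (xsection V s))).
  apply: measurable_fun_xsection_finite_kernel; rewrite inE -[V]setTI.
  exact: measurable_scons2.
by apply/funext => s; congr (l s _); rewrite xsectionE.
Qed.

HB.instance Definition _ := @isKernel.Build _ _ _ _ R mglue measurable_mglue.

Let sprob_mglue : ereal_sup [set mglue x setT | x in [set: S]] <= 1.
Proof.
apply/sprob_kernelP => x; rewrite /mglue /= /glue preimage_setT.
exact: sprob_kernel_le1.
Qed.

HB.instance Definition _ := Kernel_isSubProbability.Build
  _ _ _ _ R mglue sprob_mglue.
End glue.

Definition stay (s : S) : paths S := fun=> s.

Lemma measurable_stay : measurable_fun setT stay.
Proof. by apply: measurable_paths => i; exact: measurable_id. Qed.

Variable kappa : R.-pker S ~> S.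

Fixpoint horizon (n : nat) : R.-spker S ~> paths S :=
  if n is m.+1 then mglue (mkcomp_noparam kappa (horizon m))
  else kdirac measurable_stay.

Lemma horizonS n s A :
  horizon n.+1 s A = \int[kappa s]_t horizon n t (scons s @^-1` A).
Proof. by []. Qed.

Lemma horizon0 s A : horizon 0 s A = \d_(stay s) A.
Proof. by []. Qed.

End path_kernels.
Section path_law.
Context d (S : measurableType d) (R : realType) (kappa : R.-pker S ~> S).
Notation horizon := (horizon kappa).

Definition depends_upto n (A : set (paths S)) :=
  forall w w' : nat -> S, (forall i, (i <= n)%N -> w i = w' i) -> A w -> A w'.

Definition finitary_sets : set (set (nat -> S)) :=
  [set A | (@measurable _ (paths S) A) /\ exists n, depends_upto n A].

Lemma depends_upto_le n m A : (n <= m)%N -> depends_upto n A -> depends_upto m A.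
Proof. by move=> nm dA w w' ww' Aw; apply: dA Aw => i ni; apply/ww'/(leq_trans ni). Qed.

Lemma depends_scons n s A :
  depends_upto n.+1 A -> depends_upto n (scons s @^-1` A).
Proof.
by move=> dA w w' ww'; apply: dA => -[|i] //= ni; exact: ww'.
Qed.

Lemma finitary_sets_scons s A : finitary_sets A -> finitary_sets (scons s @^-1` A).
Proof.
move=> [mA [n dA]]; split; first exact: measurable_scons_preimage.
by exists n; apply: depends_scons; apply: depends_upto_le dA.
Qed.

Lemma horizonT n s : horizon n s setT = 1.
Proof.
elim: n s => [|n ih] s; first by rewrite horizon0 diracT.
rewrite horizonS preimage_setT; under eq_integral do rewrite ih.
by rewrite integral_cst// mul1e prob_kernel.
Qed.

Lemma horizon_dep0 m s A : depends_upto 0 A ->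
  horizon m s A = \d_(stay s) A.
Proof.
case: m => [//|m] dA; rewrite horizonS.
have [As|nAs] := pselect (A (stay s)).
- under eq_integral => t _.
    rewrite (_ : _ @^-1` _ = setT); last first.
      by apply/seteqP; split => // w _; apply: dA As => -[].
    rewrite horizonT; over.
  by rewrite integral_cst// mul1e prob_kernel diracE mem_set.
- under eq_integral => t _.
    rewrite (_ : _ @^-1` _ = set0); last first.
      apply/seteqP; split => // w Aw; apply: nAs; apply: dA Aw => -[|] //.
    rewrite measure0; over.
  by rewrite integral0 diracE memNset.
Qed.

Lemma horizon_dep n m s A : depends_upto n A -> (n <= m)%N ->
  horizon m s A = horizon n s A.
Proof.
elim: n m s A => [|n ih] m s A dA; first by rewrite !horizon_dep0.
case: m => // m nm; rewrite !horizonS; apply: eq_integral => t _.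
by apply: ih => //; exact: depends_scons.
Qed.

Definition from s (A : set (paths S)) : \bar R :=
  horizon (xget 0%N [set n | depends_upto n A]) s A.

Lemma fromE n s A : depends_upto n A -> from s A = horizon n s A.
Proof.
move=> dA; rewrite /from; case: xgetP => [m _ /= dm|/(_ n)//].
by rewrite -(horizon_dep s dm (leq_addr n m)) -(horizon_dep s dA (leq_addl m n)).
Qed.

Lemma from_scons s A : finitary_sets A ->
  from s A = \int[kappa s]_t from t (scons s @^-1` A).
Proof.
move=> [mA [n dA]].
rewrite (@fromE n.+1)//; last exact: depends_upto_le dA.
rewrite horizonS; apply: eq_integral => t _; rewrite (@fromE n)//.
by apply: depends_scons; apply: depends_upto_le dA.
Qed.

Lemma from_ge0 s A : 0 <= from s A.
Proof. exact: measure_ge0. Qed.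

Lemma from_le1 s A : finitary_sets A -> from s A <= 1.
Proof.
move=> [mA [n dA]]; rewrite (fromE _ dA).
by rewrite -(horizonT n s) le_measure ?inE.
Qed.

Lemma measurable_from A : finitary_sets A -> measurable_fun setT (from ^~ A).
Proof.
move=> [mA [n dA]]; rewrite (_ : _ ^~ _ = (horizon n ^~ A)).
  exact: measurable_kernel.
by apply/funext => s; rewrite (fromE _ dA).
Qed.

Lemma le_from s A B : finitary_sets A -> finitary_sets B -> A `<=` B ->
  from s A <= from s B.
Proof.
move=> [mA [n dA]] [mB [m dB]] AB.
rewrite (@fromE (n + m)%N)//; last exact: depends_upto_le (leq_addr _ _) dA.
rewrite (@fromE (n + m)%N)//; last exact: depends_upto_le (leq_addl _ _) dB.
by rewrite le_measure ?inE.
Qed.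

Lemma fromU s A B : finitary_sets A -> finitary_sets B -> A `&` B = set0 ->
  from s (A `|` B) = from s A + from s B.
Proof.
move=> [mA [n dA]] [mB [m dB]] AB.
have dA' : depends_upto (n + m) A by exact: depends_upto_le (leq_addr _ _) dA.
have dB' : depends_upto (n + m) B by exact: depends_upto_le (leq_addl _ _) dB.
rewrite !(@fromE (n + m)%N)// ?measureU//.
by move=> w w' ww' [Aw|Bw]; [left; apply: dA' Aw|right; apply: dB' Bw].
Qed.

Lemma finitary_sets0 : finitary_sets set0.
Proof. by split => //; exists 0%N. Qed.

Lemma finitary_setsC A : finitary_sets A -> finitary_sets (~` A).
Proof.
move=> [mA [n dA]]; split; first exact: measurableC.
exists n => w w' ww' nAw Aw'; apply: nAw; apply: dA Aw' => i ni.
by rewrite ww'.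
Qed.

Lemma finitary_setsU A B : finitary_sets A -> finitary_sets B -> finitary_sets (A `|` B).
Proof.
move=> [mA [n dA]] [mB [m dB]]; split; first exact: measurableU.
exists (n + m)%N => w w' ww' [Aw|Bw]; [left|right].
- by apply: dA Aw => i ni; rewrite ww'// (leq_trans ni)// leq_addr.
- by apply: dB Bw => i ni; rewrite ww'// (leq_trans ni)// leq_addl.
Qed.

Lemma integral_vanish (mu : {measure set S -> \bar R}) (f : nat -> S -> \bar R) :
  mu setT = 1 ->
  (forall n, measurable_fun setT (f n)) ->
  (forall n s, 0 <= f n s <= 1) ->
  (forall s, f n s @[n --> \oo] --> 0) ->
  \int[mu]_s f n s @[n --> \oo] --> 0.
Proof.
move=> mu1 mf f01 f0.
have [|||||_ _] := @dominated_convergence _ _ _ mu setT measurableT f (cst 0) (cst 1).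
- exact: mf.
- exact: measurable_cst.
- by apply: aeW => s _; exact: f0.
- apply/integrableP; split; first exact: measurable_cst.
  rewrite (_ : (fun _ => _) = cst 1); last by apply/funext => s; rewrite /cst abse1.
  by rewrite integral_cst// mul1e [ltLHS]mu1 ltry.
- by apply: aeW => s n _; have /andP[? ?] := f01 n s; rewrite gee0_abs.
by rewrite integral0.
Qed.

Lemma vanish_step (mu : {measure set S -> \bar R}) (f : nat -> S -> \bar R) :
  mu setT = 1 ->
  (forall n, measurable_fun setT (f n)) ->
  (forall n s, 0 <= f n s <= 1) ->
  ~ (\int[mu]_s f n s @[n --> \oo] --> 0) ->
  exists s, ~ (f n s @[n --> \oo] --> 0).
Proof.
move=> mu1 mf f01 h; apply: contrapT => /forallNP k; apply: h.
by apply: integral_vanish => // s; exact: contrapT (k s).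
Qed.

Lemma from_step s (A : (set (paths S))^nat) : (forall n, finitary_sets (A n)) ->
  ~ (from s (A n) @[n --> \oo] --> 0) ->
  exists t, ~ (from t (scons s @^-1` A n) @[n --> \oo] --> 0).
Proof.
move=> fA; under eq_fun do rewrite from_scons//.
have fA' n := finitary_sets_scons s (fA n).
apply: vanish_step; first exact: prob_kernel.
- by move=> n; exact: measurable_from.
- by move=> n t; rewrite from_ge0// from_le1.
Qed.

Lemma from_nonvanishing s (A : (set (paths S))^nat) :
  (forall n, finitary_sets (A n)) -> (forall m n, (m <= n)%N -> A n `<=` A m) ->
  ~ (from s (A n) @[n --> \oo] --> 0) -> \bigcap_n A n !=set0.
Proof.
move=> fA dA sA.
pose good (sA : S * (set (paths S))^nat) := [/\ forall n, finitary_sets (sA.2 n),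
  forall m n, (m <= n)%N -> sA.2 n `<=` sA.2 m &
  ~ (from sA.1 (sA.2 n) @[n --> \oo] --> 0)].
pose T := {sA | good sA}.
have next (x : T) : exists y : T,
    forall n, (sval y).2 n = scons (sval x).1 @^-1` ((sval x).2 n).
  case: x => -[t B] [/= fB dB tB].
  have [t' t'B] := from_step fB tB.
  unshelve eexists; first (exists (t', fun n => scons t @^-1` B n); split => /=).
  - by move=> n; exact: finitary_sets_scons.
  - by move=> m n mn w; exact: dB.
  - exact: t'B.
  - by [].
pose g x := projT1 (cid (next x)).
have gE x n : (sval (g x)).2 n = scons (sval x).1 @^-1` ((sval x).2 n).
  exact: (projT2 (cid (next x))).
have gA : good (s, A) by [].
pose X i := iter i g (exist _ _ gA).
pose w : paths S := fun i => (sval (X i)).1.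
pose pre n (v : paths S) : paths S := fun i => if (i < n)%N then w i else v (i - n)%N.
have preE n k v : (sval (X n)).2 k v <-> A k (pre n v).
  elim: n v => [|n ih] v.
    by rewrite /= (_ : pre 0%N v = v)//; apply/funext => i; rewrite /pre subn0.
  rewrite gE /= -/(X n) ih (_ : pre n _ = pre n.+1 v)//.
  apply/funext => i; rewrite /pre; case: ltngtP => [ni|ni|->].
  - by rewrite ltnS ltnW.
  - by rewrite ltnS leqNgt ni /= -(subnSK ni).
  - by rewrite ltnSn subnn.
exists w => k _.
have [mk [n dn]] := fA k.
have [fX dX nX] := svalP (X n).
set t := (sval (X n)).1 in nX *.
suff : (sval (X n)).2 k (stay t).
  move=> /preE; apply: dn => i ni; rewrite /pre; case: ltnP => // in_.
  by rewrite (_ : i = n)//; apply/eqP; rewrite eqn_leq ni in_.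
apply: contrapT => nk; apply: nX.
apply: cvg_near_cst; exists k => // j /= kj.
apply/eqP; rewrite eq_le from_ge0// andbT.
apply: (le_trans (le_from t (fX j) (fX k) (dX _ _ kj))).
have d0 : depends_upto 0 ((sval (X n)).2 k).
  move=> v v' vv' /preE h; apply/preE; apply: dn h => i ni.
  rewrite /pre; case: ltnP => // in_; apply: vv'.
  by rewrite leqn0 subn_eq0.
by rewrite (@fromE 0%N)// horizon_dep0// diracE memNset.
Qed.

End path_law.
Definition fpaths d (S : measurableType d) : Type := nat -> S.

Section fpaths_algebra.
Context d (S : measurableType d).
HB.instance Definition _ := Pointed.copy (fpaths S) (nat -> S).
HB.instance Definition _ := @isAlgebraOfSets.Build default_measure_display
  (fpaths S) (@finitary_sets d S) (@finitary_sets0 d S)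
  (fun A B => @finitary_setsU d S A B) (fun A => @finitary_setsC d S A).
End fpaths_algebra.

Section premeasure.
Context d (S : measurableType d) (R : realType) (kappa : R.-pker S ~> S).
Variable mu : probability S R.

Definition mass (A : set (fpaths S)) : \bar R := \int[mu]_s from kappa s A.

Let mass_ge0 A : 0 <= mass A.
Proof. by apply: integral_ge0 => s _; exact: from_ge0. Qed.

Let massU A B : finitary_sets A -> finitary_sets B -> A `&` B = set0 ->
  mass (A `|` B) = mass A + mass B.
Proof.
move=> fA fB AB; rewrite /mass -ge0_integralD//=.
- by apply: eq_integral => s _; rewrite fromU.
- exact: measurable_from.
- exact: measurable_from.
Qed.

Let mass0 : mass set0 = 0.
Proof.
apply: integral0_eq => s _; rewrite (@fromE _ _ _ _ 0%N) ?measure0//.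
Qed.

Lemma massT : mass setT = 1.
Proof.
rewrite /mass; under eq_integral => s _.
  rewrite (@fromE _ _ _ _ 0%N) ?horizonT//; over.
by rewrite integral_cst// mul1e [LHS]probability_setT.
Qed.

Let mass_cvg0 (A : (set (fpaths S))^nat) : (forall n, finitary_sets (A n)) ->
  (forall m n, (m <= n)%N -> A n `<=` A m) -> \bigcap_n A n = set0 ->
  mass (A n) @[n --> \oo] --> 0.
Proof.
move=> fA dA A0; apply: contrapT => h.
have [||||s] := @vanish_step _ S R mu (fun n s => from kappa s (A n)).
- exact: probability_setT.
- by move=> n; exact: measurable_from.
- by move=> n s; rewrite from_ge0// from_le1.
- exact: h.
move=> /(from_nonvanishing fA dA); rewrite A0 => -[]//.
Qed.

Let fin_mass A : finitary_sets A -> mass A \is a fin_num.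
Proof.
move=> fA; rewrite ge0_fin_numE ?mass_ge0// (@le_lt_trans _ _ 1) ?ltry//.
rewrite -massT ge0_le_integral//=.
- exact: measurable_from.
- by apply: measurable_from; rewrite -setC0; exact/finitary_setsC/finitary_sets0.
- move=> s _; apply: le_from => //.
  by rewrite -setC0; exact/finitary_setsC/finitary_sets0.
Qed.

Let mass_sigma_additive : semi_sigma_additive mass.
Proof.
move=> F mF tF mUF.
have fU n : finitary_sets (\big[setU/set0]_(i < n) F i).
  by have : measurable (\big[setU/set0]_(i < n) F i) by exact: bigsetU_measurable.
pose Q n := \bigcup_i F i `\` \big[setU/set0]_(i < n) F i.
have fQ n : finitary_sets (Q n).
  have : measurable (Q n) by apply: measurableD => //; exact: bigsetU_measurable.
  by [].
have sumE n : \sum_(0 <= i < n) mass (F i) = mass (\big[setU/set0]_(i < n) F i).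
  elim: n => [|n ih]; first by rewrite big_geq// big_ord0 mass0.
  rewrite big_nat_recr//= ih big_ord_recr/= massU//.
  - exact: fU.
  - exact: mF.
  - rewrite (@trivIset_bigsetUI _ xpredT)//.
    by rewrite [X in trivIset X F](_ : _ = [set: nat])//; exact/seteqP.
have QE n : \sum_(0 <= i < n) mass (F i) = mass (\bigcup_i F i) - mass (Q n).
  rewrite sumE.
  have -> : mass (\bigcup_i F i) = mass (\big[setU/set0]_(i < n) F i) + mass (Q n).
    rewrite -massU; [|exact: fU|exact: fQ|exact: setDIK].
    by rewrite setDUK//; exact: bigsetU_bigcup.
  by rewrite addeK// fin_mass.
rewrite (_ : (fun _ => _) = (fun n => mass (\bigcup_i F i) - mass (Q n))).
  2: exact/funext.
suff : (fun n => mass (\bigcup_i F i) - mass (Q n)) @ \oo -->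
    mass (\bigcup_i F i) - 0 by rewrite sube0.
apply: cvgeB; last 1 first.
- apply: mass_cvg0 => //.
    by move=> m n mn; apply: setDS; exact: subset_bigsetU.
  apply/seteqP; split => // w h.
  have [[i _ Fw] _] := h 0%N Logic.I.
  have [_ []] := h i.+1 Logic.I.
  by rewrite -bigcup_mkord; exists i => /=.
- by rewrite fin_num_adde_defl.
- exact: cvg_cst.
Qed.

HB.instance Definition _ := isMeasure.Build _ _ _ mass
  mass0 mass_ge0 mass_sigma_additive.

Let fsig := g_sigma_algebraType (@measurable _ (fpaths S)).

Let ext := measure_extension mass.

Let ext_mass A : finitary_sets A -> ext A = mass A.
Proof. by move=> fA; rewrite /ext/= /measure_extension/= measurable_mu_extE. Qed.

Let sub_fsig A : (@measurable _ (paths S) A) -> (@measurable _ fsig A).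
Proof.
move: A; apply: smallest_sub; first exact: sigma_algebra_measurable.
move=> _ [i [A [mA ->]]]; apply: sub_sigma_algebra; split.
  by apply: sub_sigma_algebra; exists i, A.
by exists i => w w' /(_ i (leqnn _)) /= ->.
Qed.

Definition path_mass (A : set (paths S)) : \bar R := ext A.

Let path_mass0 : path_mass set0 = 0.
Proof. exact: measure0. Qed.

Let path_mass_ge0 A : 0 <= path_mass A.
Proof. exact: measure_ge0. Qed.

Let path_mass_sigma_additive : semi_sigma_additive path_mass.
Proof.
move=> F mF tF mUF; apply: (@measure_semi_sigma_additive _ fsig _ ext) => //.
- by move=> i; exact: sub_fsig.
- exact: sub_fsig.
Qed.

HB.instance Definition _ := isMeasure.Build _ _ _ path_mass
  path_mass0 path_mass_ge0 path_mass_sigma_additive.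

Lemma path_massE A : finitary_sets A -> path_mass A = mass A.
Proof. exact: ext_mass. Qed.

Let path_massT : path_mass setT = 1.
Proof. by rewrite path_massE ?massT// -setC0; exact/finitary_setsC/finitary_sets0. Qed.

HB.instance Definition _ := Measure_isProbability.Build _ _ _ path_mass path_massT.

End premeasure.

Section existence.
Context d (S : measurableType d) (R : realType) (kappa : R.-pker S ~> S).

Lemma cylinder_finitary n (A : nat -> set S) : (forall i, measurable (A i)) ->
  finitary_sets (cylinder n A).
Proof.
move=> mA; split.
  rewrite (_ : cylinder n A =
      \bigcap_(i in [set i | (i <= n)%N]) [set w | A i (w i)]).
    apply: bigcap_measurable; first by exists 0%N => /=.
    by move=> i _; apply: sub_sigma_algebra; exists i, (A i).
  by [].
by exists n => w w' ww' Aw i ni; rewrite -ww'//; exact: Aw.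
Qed.

Lemma scons_cylinder n (A : nat -> set S) s :
  scons s @^-1` cylinder n.+1 A =
  if s \in A 0%N then cylinder n (fun i => A i.+1) else set0.
Proof.
case: ifPn => [/set_mem As|nAs]; apply/seteqP; split => // w.
- by move=> h i ni; exact: (h i.+1).
- by move=> h [|i] //= ni; exact: h.
- by move=> /(_ 0%N isT) /= As; move: nAs; rewrite notin_setE.
Qed.

Lemma horizon_cylinder n (A : nat -> set S) s :
  horizon kappa n s (cylinder n A) = cylinder_prob kappa n A s.
Proof.
elim: n A s => [|n ih] A s.
  rewrite horizon0 diracE /= indicE mule1; congr ((nat_of_bool _)%:R%:E).
  apply/idP/idP => /set_mem As; apply/mem_set; first exact: (As 0%N).
  by move=> i; rewrite leqn0 => /eqP ->.
rewrite horizonS scons_cylinder /= indicE; case: ifPn => _.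
  by rewrite mul1e; apply: eq_integral => t _; exact: ih.
by rewrite mul0e integral0_eq// => t _; rewrite measure0.
Qed.

Lemma path_law_exists (mu : probability S R) :
  exists P : probability (paths S) R, is_path_law kappa mu P.
Proof.
exists (path_mass kappa mu) => n A mA.
have [mC _] := cylinder_finitary n mA.
rewrite [LHS](path_massE _ _ (cylinder_finitary n mA)).
apply: eq_integral => s _; rewrite (@fromE _ _ _ _ n) ?horizon_cylinder//.
by move=> w w' ww' Aw i ni; rewrite -ww'//; exact: Aw.
Qed.

Definition cylinders : set (set (paths S)) :=
  [set C | exists n A, (forall i, measurable (A i)) /\ C = cylinder n A].

Lemma cylindersI : setI_closed cylinders.
Proof.
move=> _ _ [n [A [mA ->]]] [m [B [mB ->]]].
pose A' i := if (i <= n)%N then A i else setT.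
pose B' i := if (i <= m)%N then B i else setT.
exists (maxn n m), (fun i => A' i `&` B' i); split.
  by move=> i; apply: measurableI; rewrite /A' /B'; case: ifP.
apply/seteqP; split => w.
- move=> [Aw Bw] i _; split; rewrite /A' /B'; case: ifP => // ?;
    [exact: Aw|exact: Bw].
- move=> h; split => i im.
  + have [+ _] := h i (leq_trans im (leq_maxl _ _)).
    by rewrite /A' im.
  + have [_ +] := h i (leq_trans im (leq_maxr _ _)).
    by rewrite /B' im.
Qed.

Lemma path_law_unique (mu : probability S R) (P Q : probability (paths S) R) :
  is_path_law kappa mu P -> is_path_law kappa mu Q ->
  forall E, measurable E -> P E = Q E.
Proof.
move=> PL QL E mE.
have mcyl : cylinders `<=` measurable.
  by move=> _ [n [A [mA ->]]]; exact: (cylinder_finitary n mA).1.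
have cT : cylinders setT.
  by exists 0%N, (fun=> setT); split => //; apply/seteqP; split.
apply: (@g_sigma_algebra_measure_unique _ _ _ cylinders mcyl (fun=> setT)) => //.
- by rewrite bigcup_const.
- exact: cylindersI.
- by move=> _ [n [A [mA ->]]]; exact: etrans (PL n A mA) (esym (QL n A mA)).
- by move=> k; rewrite (le_lt_trans (probability_le1 _ _))// ltry.
- move: E mE; apply: smallest_sub; first exact: smallest_sigma_algebra.
  move=> _ [i [A [mA ->]]]; apply: sub_sigma_algebra.
  exists i, (fun j => if j == i then A else setT); split.
    by move=> j; case: ifP.
  apply/seteqP; split => w /= h; first by move=> j _; case: eqP => // ->.
  by have := h i (leqnn i); rewrite eqxx.
Qed.
End existence.

End PathLaw.

Definition Prob d (S : measurableType d) (R : realType)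
    (kappa : R.-pker S ~> S) (mu : probability S R) : probability (paths S) R :=
  projT1 (cid (PathLaw.path_law_exists kappa mu)).

Lemma Prob_path_law d (S : measurableType d) (R : realType)
    (kappa : R.-pker S ~> S) (mu : probability S R) :
  is_path_law kappa mu (Prob kappa mu).
Proof. exact: projT2 (cid (PathLaw.path_law_exists kappa mu)). Qed.

Lemma Prob_unique d (S : measurableType d) (R : realType)
    (kappa : R.-pker S ~> S) (mu : probability S R)
    (P : probability (paths S) R) : is_path_law kappa mu P ->
  forall E, measurable E -> P E = Prob kappa mu E.
Proof. by move=> PL; apply: PathLaw.path_law_unique PL (Prob_path_law _ _). Qed.

Section events.
Context d (S : measurableType d).
Implicit Type B : set S.

Definition ev_F B : set (paths S) := [set w | exists i, B (w i)].

Definition ev_Fge (p : nat) B : set (paths S) :=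
  [set w | exists2 i, (p <= i)%N & B (w i)].

Definition ev_GF B : set (paths S) := [set w | infinite_set [set i | B (w i)]].

Definition ev_step B' B : set (paths S) := [set w | B' (w 0%N) /\ B (w 1%N)].

End events.

(* Only meaningful when 0 < P C. *)
Definition cond_prob d (T : measurableType d) (R : realType)
    (P : probability T R) (E C : set T) : R :=
  (fine (P (E `&` C)) / fine (P C))%R.

Section sts.
Context d (S : measurableType d) (R : realType) (kappa : R.-pker S ~> S).
Implicit Types (B : set S) (BB : set (set S)) (mu : probability S R).

Definition avoid_set B : set S :=
  [set s | Prob kappa (dirac s) (ev_F B) = 0].

Definition attractor B :=
  measurable B /\ forall mu, Prob kappa mu (ev_F B) = 1.

Definition has_finite_attractor := exists2 B, finite_set B & attractor B.

Definition decisive BB := forall B mu, BB B ->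
  Prob kappa mu (ev_F B `|` ev_F (avoid_set B)) = 1.

Definition strongly_decisive BB := forall B mu, BB B ->
  Prob kappa mu (ev_GF B `|` ev_F (avoid_set B)) = 1.

Definition persistently_decisive BB := forall B mu, BB B -> forall p,
  Prob kappa mu (ev_Fge p B `|` ev_Fge p (avoid_set B)) = 1.

Definition fair BB := forall B mu B', BB B -> measurable B' ->
  (forall mu', mu' B' = 1 -> 0 < Prob kappa mu' (ev_step B' B)) ->
  0 < Prob kappa mu (ev_GF B') ->
  cond_prob (Prob kappa mu) (ev_GF B) (ev_GF B') = 1%R.

Definition Omega mu (A : set S) : \bar R := \int[mu]_s kappa s A.

End sts.

Definition denumerable_MC d (S : measurableType d) (R : realType)
    (kappa : R.-pker S ~> S) :=
  countable [set: S] /\ forall A : set S, measurable A.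

Definition finite_MC d (S : measurableType d) (R : realType)
    (kappa : R.-pker S ~> S) :=
  denumerable_MC kappa /\ finite_set [set: S].

Section abstraction.
Context d1 d2 (S1 : measurableType d1) (S2 : measurableType d2) (R : realType).
Variables (kappa1 : R.-pker S1 ~> S1) (kappa2 : R.-pker S2 ~> S2).
Variable alpha : {mfun S1 >-> S2}.

Definition is_abstraction :=
  forall (mu : probability S1 R) (A : set S2), measurable A ->
    pushforward (Omega kappa1 mu) alpha A = 0 <->
    Omega kappa2 (distribution mu alpha) A = 0.

Definition is_sound_abstraction := is_abstraction /\
  forall (mu : probability S1 R) (B : set S2), measurable B ->
    Prob kappa2 (distribution mu alpha) (ev_F B) = 1 ->
    Prob kappa1 mu (ev_F (alpha @^-1` B)) = 1.

End abstraction.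

(* Main.v *)
(** (b) Let C = B \/ avoid B in the abstraction and let u(s) be the probability
   of never reaching C from s.  Then u < 1 everywhere, so u <= c < 1 on the
   finite attractor, hence everywhere (before reaching the attractor nothing is
   lost).  By the Markov property u(s) <= c P_s(C not reached within n steps) for
   all n, so u <= c u and u = 0: the abstraction is decisive.  Null sets of the
   n-step laws correspond under alpha, so avoid-sets do too, and soundness makes
   the concrete system decisive.

   (c) Decisiveness from the law after p steps gives persistent decisiveness; if
   B \/ avoid B is visited at arbitrarily late times, then either avoid B is
   visited or B is visited infinitely often.

   (d) avoid B is almost surely absorbing and disjoint from any B' which reaches B
   in one step with positive probability, so visiting B' infinitely often
   excludes visiting avoid B. *)

From HB Require Import structures.
Require Import Defs.
From mathcomp Require Import all_boot all_order all_algebra.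
From mathcomp Require Import all_classical all_reals all_analysis.
From mathcomp Require Import measurable_realfun.

Set Implicit Arguments.
Unset Strict Implicit.
Unset Printing Implicit Defensive.
Import Order.TTheory GRing.Theory Num.Theory.
Import numFieldNormedType.Exports.
Local Open Scope classical_set_scope.
Local Open Scope ring_scope.
Local Open Scope ereal_scope.

(** * The law of the chain after one step, as a probability measure *)

Section omega.
Context d (S : measurableType d) (R : realType) (kappa : R.-pker S ~> S).
Variable mu : probability S R.

(** Reading [mu] as a constant kernel turns [Omega] into a kernel composition, which supplies
    sigma-additivity and the iterated integral formula. *)
Let init : R.-pker S ~> S :=
  kprobability (measurable_cst (mu : pprobability S R)).

(* [kernel_snd] makes [kappa] ignore the first argument that [kcomp] feeds it. *)
Let OmegaE : Omega kappa mu = kcomp init (kernel.kernel_snd kappa) point.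
Proof. by []. Qed.

Let Omega0 : Omega kappa mu set0 = 0.
Proof. by rewrite OmegaE measure0. Qed.

Let Omega_ge0 A : 0 <= Omega kappa mu A.
Proof. by rewrite OmegaE. Qed.

Let Omega_sigma_additive : semi_sigma_additive (Omega kappa mu).
Proof. by rewrite OmegaE; exact: measure_semi_sigma_additive. Qed.

HB.instance Definition _ := isMeasure.Build _ _ _ (Omega kappa mu)
  Omega0 Omega_ge0 Omega_sigma_additive.

Let Omega_setT : Omega kappa mu setT = 1.
Proof.
rewrite /Omega; under eq_integral do rewrite prob_kernel.
by rewrite integral_cst// mul1e [LHS]probability_setT.
Qed.

HB.instance Definition _ :=
  Measure_isProbability.Build _ _ _ (Omega kappa mu) Omega_setT.

Definition omega : probability S R := Omega kappa mu.

Lemma integral_omega (f : S -> \bar R) : (forall s, 0 <= f s) ->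
  measurable_fun setT f ->
  \int[omega]_s f s = \int[mu]_s \int[kappa s]_t f t.
Proof.
move=> f0 mf.
exact: (@integral_kcomp _ _ _ _ _ _ _ init (kernel.kernel_snd kappa) point).
Qed.

End omega.

(** * Cylinder probabilities and the Markov property at time 1 *)

Section path_law.
Context d (S : measurableType d) (R : realType) (kappa : R.-pker S ~> S).
Implicit Types (mu : probability S R) (A B : set S) (E : set (paths S)).

(** Identifying [cylinder_prob] with a value of the kernel [horizon] yields measurability here and
    the bounds 0 and 1 below. *)
Lemma measurable_cylinder_prob n (A : nat -> set S) :
  (forall i, measurable (A i)) -> measurable_fun setT (cylinder_prob kappa n A).
Proof.
move=> mA; rewrite (_ : cylinder_prob _ _ _ =
    fun s => PathLaw.horizon kappa n s (cylinder n A)).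
  by apply: measurable_kernel; exact: (PathLaw.cylinder_finitary n mA).1.
by apply/funext => s; rewrite PathLaw.horizon_cylinder.
Qed.

Lemma cylinder_prob_ge0 n (A : nat -> set S) s : 0 <= cylinder_prob kappa n A s.
Proof. by rewrite -PathLaw.horizon_cylinder. Qed.

Lemma cylinder_prob_le1 n (A : nat -> set S) s :
  (forall i, measurable (A i)) -> cylinder_prob kappa n A s <= 1.
Proof.
move=> mA; rewrite -PathLaw.horizon_cylinder -(PathLaw.horizonT kappa n s).
by rewrite le_measure ?inE//; exact: (PathLaw.cylinder_finitary n mA).1.
Qed.

Lemma integral_dirac_prob (f : S -> \bar R) s : measurable_fun setT f ->
  \int[dirac s : probability S R]_t f t = f s.
Proof. by move=> mf; rewrite integral_dirac// diracT mul1e. Qed.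

Definition shift (w : paths S) : paths S := fun n => w n.+1.

Lemma measurable_shift : measurable_fun setT shift.
Proof.
by apply: PathLaw.measurable_paths => i; exact: PathLaw.measurable_coord.
Qed.

HB.instance Definition _ := isMeasurableFun.Build _ _ _ _ _ measurable_shift.

(** Markov property: the shifted law is a path law started from [omega kappa mu], so uniqueness
    applies. On cylinders, shifting prepends an unconstrained coordinate, encoded by [setT] in
    [A']. *)
Lemma Prob_shift mu E : measurable E ->
  Prob kappa mu (shift @^-1` E) = Prob kappa (omega kappa mu) E.
Proof.
move=> mE.
rewrite -[LHS]/(distribution (Prob kappa mu) shift E).
apply: Prob_unique => // n A mA.
pose A' i := if i is j.+1 then A j else setT.
transitivity (Prob kappa mu (cylinder n.+1 A')).
  congr (Prob kappa mu _); apply/seteqP; split => w h.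
    by case=> // i; exact: h.
  by move=> i ni; exact: (h i.+1 ni).
rewrite Prob_path_law; last by move=> [|i]; [exact: measurableT|exact: mA].
rewrite integral_omega//; last exact: measurable_cylinder_prob.
- by apply: eq_integral => s _; rewrite /= indicT mul1e.
- by move=> s; exact: cylinder_prob_ge0.
Qed.

Lemma ev_FgeS p B : ev_Fge p.+1 B = shift @^-1` ev_Fge p B.
Proof.
apply/seteqP; split => w; first by case=> -[|i] // pi Bi; exists i.
by case=> i pi Bi; exists i.+1.
Qed.

End path_law.

(** * Almost sure events *)

Section probability.
Context d (T : measurableType d) (R : realType) (P : probability T R).

Lemma probability_setC_eq1 E : measurable E -> P (~` E) = 1 <-> P E = 0.
Proof.
move=> mE; rewrite probability_setC// -[P E]fineK ?fin_num_measure//.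
split=> [[/eqP]|[->]]; last by rewrite sube0.
by rewrite subr_eq addrC -subr_eq subrr => /eqP <-.
Qed.

Lemma probability_setC_eq0 E : measurable E -> P (~` E) = 0 <-> P E = 1.
Proof.
move=> mE; rewrite -[in P E = 1](setCK E) probability_setC_eq1//.
exact: measurableC.
Qed.

Lemma probability1S A B : measurable A -> measurable B -> A `<=` B ->
  P A = 1 -> P B = 1.
Proof.
move=> mA mB AB PA; apply/eqP; rewrite eq_le probability_le1//= -PA.
by rewrite le_measure ?inE.
Qed.

Lemma probability_bigcap_eq1 (F : nat -> set T) :
  (forall n, measurable (F n)) -> (forall n, P (F n) = 1) ->
  P (\bigcap_n F n) = 1.
Proof.
move=> mF F1; apply/probability_setC_eq0; first exact: bigcapT_measurable.
rewrite setC_bigcap; apply/negligibleP.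
  by apply: bigcupT_measurable => n; exact: measurableC.
apply: negligible_bigcup => n; apply/negligibleP; first exact: measurableC.
exact/probability_setC_eq0.
Qed.

End probability.

(** * Measurability and decomposition of path events *)

Section events.
Context d (S : measurableType d).
Implicit Types (B : set S).

Lemma measurable_at (i : nat) B : measurable B ->
  measurable [set w : paths S | B (w i)].
Proof.
by move=> /(@PathLaw.measurable_coord _ S i measurableT); rewrite setTI.
Qed.

Lemma measurable_ev_Fge p B : measurable B -> measurable (ev_Fge p B).
Proof.
move=> mB; rewrite (_ : ev_Fge p B =
    \bigcup_(i in [set i | (p <= i)%N]) [set w : paths S | B (w i)]).
  by apply: bigcup_measurable => i _; exact: measurable_at.
by apply/seteqP; split => w [i pi Bi]; exists i.
Qed.

Lemma ev_Fge0 B : ev_Fge 0 B = ev_F B.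
Proof. by apply/seteqP; split => w [i]; [exists i|exists i]. Qed.

Lemma measurable_ev_F B : measurable B -> measurable (ev_F B).
Proof. by rewrite -ev_Fge0; exact: measurable_ev_Fge. Qed.

Lemma ev_GFE B : ev_GF B = \bigcap_p ev_Fge p B.
Proof.
apply/seteqP; split => w.
  move=> infB p _; apply: contrapT => noB; apply: infB.
  apply: (sub_finite_set _ (finite_II p)) => i /= Bi.
  by rewrite ltnNge; apply/negP => pi; apply: noB; exists i.
move=> h /finite_seqP[r rB].
(* A visit strictly later than every listed visiting time contradicts the finiteness of the list
   [r]. *)
have [i maxi Bi] := h (\max_(i <- r) i).+1 Logic.I.
have : [set i | B (w i)] i by [].
rewrite rB /= => ir.
by move: maxi; rewrite ltnNge leq_bigmax_seq.
Qed.

Lemma measurable_ev_GF B : measurable B -> measurable (ev_GF B).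
Proof.
move=> mB; rewrite ev_GFE; apply: bigcapT_measurable => p.
exact: measurable_ev_Fge.
Qed.

Lemma ev_FU A B : ev_F (A `|` B) = ev_F A `|` ev_F B.
Proof.
apply/seteqP; split => w; first by case=> i [Ai|Bi]; [left|right]; exists i.
by case=> -[i]; exists i; [left|right].
Qed.

End events.

(** * The probability of never reaching a set, as a function of the starting state *)

Section avoidance.
Context d (S : measurableType d) (R : realType) (kappa : R.-pker S ~> S).
Implicit Types (mu : probability S R) (A B : set S).

Lemma bounded_cvg_integral (mu : {measure set S -> \bar R})
    (f : nat -> S -> \bar R) (g : S -> \bar R) :
  mu setT = 1 -> (forall n, measurable_fun setT (f n)) ->
  (forall n s, 0 <= f n s <= 1) -> (forall s, f n s @[n --> \oo] --> g s) ->
  \int[mu]_s f n s @[n --> \oo] --> \int[mu]_s g s.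
Proof.
move=> mu1 mf f01 fg.
have mg : measurable_fun setT g.
  by apply: (emeasurable_fun_cvg f) => // s _; exact: fg.
have [|||_ _] :=
    @dominated_convergence _ _ _ mu setT measurableT f g (cst 1) mf mg.
- by apply: aeW => s _; exact: fg.
- apply/integrableP; split; first exact: measurable_cst.
  under eq_integral do rewrite abse1.
  by rewrite integral_cst// mul1e [ltLHS]mu1 ltry.
- by apply: aeW => s n _; have /andP[? ?] := f01 n s; rewrite gee0_abs.
by [].
Qed.

(** Avoidance is preferred to reachability because it is the limit of cylinder probabilities, which
    obey a one-step recursion. *)
Definition never B s : \bar R := Prob kappa (dirac s) (~` ev_F B).

Lemma never_ge0 B s : 0 <= never B s.
Proof. exact: measure_ge0. Qed.

Lemma never_le1 B s : measurable B -> never B s <= 1.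
Proof.
by move=> mB; exact: probability_le1 (measurableC (measurable_ev_F mB)).
Qed.

Lemma fin_num_never B s : measurable B -> never B s \is a fin_num.
Proof.
by move=> mB; exact: fin_num_measure (measurableC (measurable_ev_F mB)).
Qed.

(** Continuity from above, along the events that [B] is avoided up to time n. *)
Lemma cvg_Prob_cylinderC mu B : measurable B ->
  Prob kappa mu (cylinder n (fun=> ~` B)) @[n --> \oo] -->
  Prob kappa mu (~` ev_F B).
Proof.
move=> mB.
have mC n : measurable (cylinder n (fun=> ~` B)).
  by apply: (PathLaw.cylinder_finitary _ _).1 => _; exact: measurableC.
have -> : ~` ev_F B = \bigcap_n cylinder n (fun=> ~` B).
  apply/seteqP; split => w.
    by move=> h n _ i _ Bi; apply: h; exists i.
  by move=> h [i Bi]; exact: (h i Logic.I i (leqnn i)).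
apply: (@nonincreasing_cvg_mu _ _ _ _ (fun n => cylinder n (fun=> ~` B))) => //.
- by rewrite (le_lt_trans (probability_le1 _ _))// ltry.
- exact: bigcapT_measurable.
- by move=> m n mn; apply/subsetPset => w h i im; exact/h/(leq_trans im).
Qed.

Lemma cvg_never B s : measurable B ->
  cylinder_prob kappa n (fun=> ~` B) s @[n --> \oo] --> never B s.
Proof.
move=> mB; have mB' (i : nat) : measurable (~` B) by exact: measurableC.
rewrite [X in X @ _ --> _](_ : _ =
    fun n => Prob kappa (dirac s) (cylinder n (fun=> ~` B))).
  exact: cvg_Prob_cylinderC.
apply/funext => n; rewrite /= Prob_path_law// integral_dirac_prob//.
exact: measurable_cylinder_prob.
Qed.

Lemma measurable_never B : measurable B -> measurable_fun setT (never B).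
Proof.
move=> mB; have mB' (i : nat) : measurable (~` B) by exact: measurableC.
apply: (emeasurable_fun_cvg (fun n => cylinder_prob kappa n (fun=> ~` B))).
  by move=> n; exact: measurable_cylinder_prob.
by move=> s _; exact: cvg_never.
Qed.

Lemma cvg_integral_never (mu : {measure set S -> \bar R}) B : measurable B ->
  mu setT = 1 ->
  \int[mu]_s cylinder_prob kappa n (fun=> ~` B) s @[n --> \oo] -->
  \int[mu]_s never B s.
Proof.
move=> mB mu1; have mB' (i : nat) : measurable (~` B) by exact: measurableC.
apply: bounded_cvg_integral => //.
- by move=> n; exact: measurable_cylinder_prob.
- by move=> n s; rewrite cylinder_prob_ge0 cylinder_prob_le1.
- by move=> s; exact: cvg_never.
Qed.

(** Both sides are limits of the same cylinder probabilities, the right one by dominated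
    convergence. *)
Lemma Prob_never mu B : measurable B ->
  Prob kappa mu (~` ev_F B) = \int[mu]_s never B s.
Proof.
move=> mB; have mB' (i : nat) : measurable (~` B) by exact: measurableC.
have h := @cvg_integral_never mu B mB (probability_setT mu).
apply: cvg_unique h => //=; rewrite [X in X @ _ --> _](_ : _ =
    fun n => Prob kappa mu (cylinder n (fun=> ~` B))).
  exact: cvg_Prob_cylinderC.
by apply/funext => n; rewrite Prob_path_law.
Qed.

(** Pass to the limit in the recursion that defines [cylinder_prob]. *)
Lemma never_step B s : measurable B ->
  never B s = (\1_(~` B) s)%:E * \int[kappa s]_t never B t.
Proof.
move=> mB; have := @cvg_never B s mB; rewrite -cvg_shiftS /= => h.
apply: cvg_unique h _ => //; apply: cvgeZl => //.
by apply: cvg_integral_never => //; exact: prob_kernel.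
Qed.

Lemma avoid_setE B : measurable B ->
  avoid_set kappa B = [set s | never B s = 1].
Proof.
move=> mB; have mF := measurable_ev_F mB.
by apply/seteqP; split => s; rewrite /avoid_set /never /= probability_setC_eq1.
Qed.

Lemma measurable_avoid_set B : measurable B -> measurable (avoid_set kappa B).
Proof.
move=> mB; rewrite avoid_setE//; rewrite -[X in measurable X]setTI.
exact: (measurable_never mB measurableT (emeasurable_set1 1)).
Qed.

End avoidance.

(** * Equivalence of the decisiveness notions, and fairness *)

Section decisiveness.
Context d (S : measurableType d) (R : realType) (kappa : R.-pker S ~> S).
Implicit Types (mu : probability S R) (A B C : set S).

Variable BB : set (set S).
Hypothesis mBB : forall B, BB B -> measurable B.

(** Decisiveness holds for every initial law, so each unit of delay p is absorbed by moving from
    [mu] to [omega kappa mu]. *)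
Lemma decisive_persistently_decisive :
  decisive kappa BB -> persistently_decisive kappa BB.
Proof.
move=> dec B mu BBB p; elim: p mu => [|p ih] mu; first by rewrite !ev_Fge0 dec.
have mB := mBB BBB; have mA := measurable_avoid_set kappa mB.
rewrite -(ih (omega kappa mu)) -Prob_shift; last first.
  by apply: measurableU; exact: measurable_ev_Fge.
by rewrite preimage_setU !ev_FgeS.
Qed.

Lemma persistently_decisive_strongly_decisive :
  persistently_decisive kappa BB -> strongly_decisive kappa BB.
Proof.
move=> pdec B mu BBB.
have mB := mBB BBB; have mA := measurable_avoid_set kappa mB.
apply: (probability1S _ _ _ (@probability_bigcap_eq1 _ _ _ (Prob kappa mu) _ _
    (fun p => pdec B mu BBB p))).
- apply: bigcapT_measurable => p.
  by apply: measurableU; exact: measurable_ev_Fge.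
- by apply: measurableU; [exact: measurable_ev_GF|exact: measurable_ev_F].
- move=> w h; have [[i Ai]|noA] := pselect (ev_F (avoid_set kappa B) w).
    by right; exists i.
  left; rewrite ev_GFE => p _; have [//|[i _ Ai]] := h p Logic.I.
  by case: noA; exists i.
- by move=> p; apply: measurableU; exact: measurable_ev_Fge.
Qed.

Lemma strongly_decisive_decisive :
  strongly_decisive kappa BB -> decisive kappa BB.
Proof.
move=> sdec B mu BBB.
have mB := mBB BBB; have mA := measurable_avoid_set kappa mB.
apply: (probability1S _ _ _ (sdec B mu BBB)).
- by apply: measurableU; [exact: measurable_ev_GF|exact: measurable_ev_F].
- by apply: measurableU; exact: measurable_ev_F.
- apply: setSU; rewrite ev_GFE -ev_Fge0 => w; exact.
Qed.

Lemma Prob_ev_step mu A B : measurable A -> measurable B ->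
  Prob kappa mu (ev_step A B) = \int[mu]_s ((\1_A s)%:E * kappa s B).
Proof.
move=> mA mB; pose AB i := if i is 0%N then A else B.
have -> : ev_step A B = cylinder 1 AB.
  apply/seteqP; split => w; first by move=> [Aw Bw] [|[|]].
  by move=> h; split; [exact: (h 0%N)|exact: (h 1%N)].
rewrite Prob_path_law; last by case.
apply: eq_integral => s _ /=; congr (_ * _).
by under eq_integral do rewrite mule1; rewrite integral_indic// setIT.
Qed.

(** The induction on the time i ranges over all initial laws, since each shift replaces [mu] by
    [omega kappa mu]. *)
Lemma Prob_step_eq0 A B : measurable A -> measurable B ->
  (forall s, A s -> kappa s B = 0) ->
  forall i mu, Prob kappa mu [set w : paths S | A (w i) /\ B (w i.+1)] = 0.
Proof.
move=> mA mB AB; elim=> [|i ih] mu.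
  rewrite [LHS](@Prob_ev_step mu A B)// integral0_eq// => s _.
  rewrite indicE; case: (boolP (s \in A)) => [/set_mem/AB ->|_].
    by rewrite mule0.
  by rewrite mul0e.
rewrite -[RHS](ih (omega kappa mu)) -Prob_shift//.
by apply: measurableI; exact: measurable_at.
Qed.

(** On [B] the indicator in [never_step] vanishes, whereas [never] equals 1 on the avoid-set. *)
Lemma avoid_set_disjoint B s : measurable B -> avoid_set kappa B s -> ~ B s.
Proof.
move=> mB; rewrite avoid_setE//= never_step// => + Bs.
rewrite indicE memNset ?mul0e; last by move=> /(_ Bs).
by move=> /eqP; rewrite lt_eqF.
Qed.

(** By [never_step] the mean of [never kappa B] under [kappa s] is 1. A function bounded by 1 with
    mean 1 equals 1 almost everywhere. *)
Lemma avoid_set_absorbing B s : measurable B -> avoid_set kappa B s ->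
  kappa s (~` avoid_set kappa B) = 0.
Proof.
move=> mB aBs; have nBs := avoid_set_disjoint mB aBs.
move: aBs; rewrite avoid_setE//= never_step// indicE mem_set// mul1e => h.
have mn := measurable_never kappa mB.
have mn' : measurable_fun setT (fun t => 1 - never kappa B t).
  by apply: emeasurable_funB => //; exact: measurable_cst.
have n0 t : 0 <= 1 - never kappa B t.
  by rewrite sube_ge0 ?fin_num_never ?never_le1.
have i0 : \int[kappa s]_t (1 - never kappa B t) = 0.
  have : \int[kappa s]_t (1 - never kappa B t) +
      \int[kappa s]_t never kappa B t = 1.
    rewrite -ge0_integralD//.
    rewrite (eq_integral (cst 1)).
      by rewrite integral_cst// mul1e prob_kernel.
    by move=> t _; rewrite /= subeK ?fin_num_never.
  rewrite h => /eqP; rewrite eq_sym -sube_eq//.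
    2: by rewrite fin_num_adde_defl.
  by rewrite subee// => /eqP <-.
have [N [mN N0 hN]] :
    ae_eq (kappa s) setT (fun t => 1 - never kappa B t) (cst 0).
  apply/(ae_eq_integral_abs _ measurableT mn').
  by rewrite -[RHS]i0; apply: eq_integral => t _; rewrite gee0_abs.
apply: (subset_measure0 _ mN _ N0).
  by apply: measurableC; rewrite -avoid_setE//; exact: measurable_avoid_set.
move=> t /= ht; apply: hN => /= /(_ Logic.I) /eqP.
rewrite sube_eq//.
by rewrite add0e => /eqP /esym.
Qed.

Lemma strongly_decisive_fair : strongly_decisive kappa BB -> fair kappa BB.
Proof.
move=> sdec B mu B' BBB mB' B'B PB'.
have mB := mBB BBB; have mA := measurable_avoid_set kappa mB.
set P := Prob kappa mu in PB' *.
set Z := avoid_set kappa B in mA *.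
(* For s in both sets, the hypothesis on [B'] at [dirac s] gives [kappa s B] > 0. But [kappa s] is
   carried by [Z], which is disjoint from [B]. *)
have ZB' s : Z s -> ~ B' s.
  move=> Zs B's; have := B'B (dirac s).
  rewrite Prob_ev_step// integral_dirac_prob; last first.
    apply: emeasurable_funM; first exact/measurable_EFinP.
    exact: measurable_kernel.
  rewrite [X in X = 1 -> _]diracE mem_set// indicE mem_set// mul1e.
  move=> /(_ erefl).
  rewrite (_ : kappa s B = 0) ?ltxx//.
  apply: (subset_measure0 _ _ _ (avoid_set_absorbing mB Zs)) => //.
    exact: measurableC.
  by move=> t Bt /(avoid_set_disjoint mB).
pose leave i := [set w : paths S | Z (w i) /\ (~` Z) (w i.+1)].
have mleave i : measurable (leave i).
  by apply: measurableI; apply: measurable_at => //; exact: measurableC.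
have leave0 i : P (leave i) = 0.
  apply: Prob_step_eq0 => //; first exact: measurableC.
  by move=> s; exact: avoid_set_absorbing.
have mG : measurable (ev_GF B) by exact: measurable_ev_GF.
have mG' : measurable (ev_GF B') by exact: measurable_ev_GF.
have mGF : measurable (ev_GF B `|` ev_F Z).
  by apply: measurableU => //; exact: measurable_ev_F.
(* Outside the null set of strong decisiveness such a path enters [Z]. It then either leaves [Z] at
   some time, a null event, or stays there and visits [B'] only finitely often. *)
have D0 : P (ev_GF B' `\` ev_GF B) = 0.
  have mU : measurable (\bigcup_i leave i) by exact: bigcupT_measurable.
  apply: (@subset_measure0 _ _ _ _ _
      (~` (ev_GF B `|` ev_F Z) `|` \bigcup_i leave i)).
  - exact: measurableD.
  - by apply: measurableU => //; exact: measurableC.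
  - move=> w [GB' nGB].
    have [[//|[i Zi]]|nGF] := pselect ((ev_GF B `|` ev_F Z) w); last by left.
    right; apply: contrapT => stay.
    have Zj j : Z (w (i + j)%N).
      elim: j => [|j ihj]; first by rewrite addn0.
      by rewrite addnS; apply: contrapT => nZ; apply: stay; exists (i + j)%N.
    move: GB'; rewrite ev_GFE => /(_ i Logic.I)[j ij].
    by rewrite -(subnKC ij); exact: ZB'.
  - apply/negligibleP.
      by apply: measurableU => //; exact: measurableC.
    apply: negligibleU; last first.
      apply: negligible_bigcup => i.
      by apply/negligibleP; [exact: mleave|exact: leave0].
    apply/negligibleP; first exact: measurableC.
    exact: (probability_setC_eq0 P mGF).2 (sdec B mu BBB).
rewrite /cond_prob -/P.
have -> : P (ev_GF B `&` ev_GF B') = P (ev_GF B').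
  rewrite setIC; rewrite [RHS](measureDI _ mG' mG).
  by rewrite -[X in X + _]/(P _) D0 add0e.
by rewrite divff// fine_eq0 ?fin_num_measure// gt_eqF.
Qed.

End decisiveness.

(** * Decisiveness of a chain with a finite attractor *)

Lemma finite_set_lt1 (T : choiceType) (R : realType) (f : T -> \bar R)
    (A : set T) : finite_set A ->
  (forall s, 0 <= f s < 1) ->
  exists c : R, [/\ (0 <= c < 1)%R & forall s, A s -> f s <= c%:E].
Proof.
move=> /finite_seqP[r ->] f01; elim: r => [|a r [c [/andP[c0 c1] cr]]].
  (* With no state to bound, 0 serves as the default value of c. *)
  by exists 0%R; rewrite lexx ltr01.
have /andP[fa0 fa1] := f01 a.
have fa : f a = (fine (f a))%:E.
  by rewrite fineK// ge0_fin_numE// (lt_trans fa1)// ltry.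
exists (Num.max c (fine (f a))); split.
  by rewrite le_max c0/= gt_max c1 -lte_fin -fa.
move=> s; rewrite /= inE => /orP[/eqP ->|rs].
  by rewrite fa lee_fin le_max lexx orbT.
by rewrite (le_trans (cr s rs))// lee_fin le_max lexx.
Qed.

Section finite_attractor.
Context d (S : measurableType d) (R : realType) (kappa : R.-pker S ~> S).
Implicit Types (mu : probability S R) (A B C : set S).

Lemma never_mem B s : measurable B -> B s -> never kappa B s = 0.
Proof.
by move=> mB Bs; rewrite never_step// indicE memNset ?mul0e.
Qed.

Lemma never_le_integral B s : measurable B ->
  never kappa B s <= \int[kappa s]_t never kappa B t.
Proof.
move=> mB; rewrite [leLHS]never_step// indicE.
have i0 : 0 <= \int[kappa s]_t never kappa B t.
  by apply: integral_ge0 => t _; exact: never_ge0.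
by case: (s \in ~` B); rewrite ?mul1e ?mul0e.
Qed.

(** With value 1 at s, almost no path from s reaches [B], so s lies in the avoid-set of [B]. Then
    the target is reached at time 0 and the value is 0. *)
Lemma never_avoid_lt1 B s : measurable B ->
  never kappa (B `|` avoid_set kappa B) s < 1.
Proof.
move=> mB; have mA := measurable_avoid_set kappa mB.
have mC : measurable (B `|` avoid_set kappa B) by exact: measurableU.
rewrite lt_neqAle never_le1// andbT; apply/eqP => n1.
have : avoid_set kappa (B `|` avoid_set kappa B) s by rewrite avoid_setE.
rewrite /avoid_set /= ev_FU => F0.
have As : avoid_set kappa B s.
  apply: (subset_measure0 _ _ _ F0).
  - exact: measurable_ev_F.
  - by apply: measurableU; exact: measurable_ev_F.
  - exact: subsetUl.
by move: n1; rewrite never_mem//; [move=> /eqP; rewrite lt_eqF|right].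
Qed.

(** Only paths that have not yet met [A] can add to the bound c, by at most 1 - c, and their
    probability tends to 0. *)
Lemma never_le_attractor A C (c : R) : measurable A -> measurable C ->
  (0 <= c <= 1)%R ->
  (forall s, A s -> never kappa C s <= c%:E) ->
  (forall s, never kappa A s = 0) ->
  forall s, never kappa C s <= c%:E.
Proof.
move=> mA mC /andP[c0 c1] Cc A0 s.
have mA' (i : nat) : measurable (~` A) by exact: measurableC.
have mv n := measurable_cylinder_prob kappa n mA'.
have c1' : 0 <= (1 - c)%:E :> \bar R by rewrite lee_fin subr_ge0.
(* Markov property at the first visit to A within n steps. *)
have bound n t : never kappa C t <=
    c%:E + (1 - c)%:E * cylinder_prob kappa n (fun=> ~` A) t.
  have [At|nAt] := pselect (A t).
    by rewrite (le_trans (Cc t At))// leeDl// mule_ge0// cylinder_prob_ge0.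
  elim: n t nAt => [|n ih] t nAt.
    rewrite /= indicE mem_set// !mule1 -EFinD addrC subrK.
    exact: never_le1.
  rewrite /= indicE mem_set// mul1e.
  rewrite (le_trans (never_le_integral t mC))//.
  rewrite (@le_trans _ _ (\int[kappa t]_x (c%:E +
      (1 - c)%:E * cylinder_prob kappa n (fun=> ~` A) x)))//.
    apply: ge0_le_integral => //.
    - exact: measurable_never.
    - apply: emeasurable_funD; first exact: measurable_cst.
      by apply: emeasurable_funM => //; exact: measurable_cst.
    - move=> x _; have [Ax|nAx] := pselect (A x); last exact: ih.
      by rewrite (le_trans (Cc x Ax))// leeDl// mule_ge0// cylinder_prob_ge0.
  rewrite ge0_integralD//=.
  - rewrite ge0_integralZl//; last by move=> x _; exact: cylinder_prob_ge0.
    rewrite integral_cst// -[X in _ * X]/(kappa t setT) prob_kernel mule1.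
    by rewrite lexx.
  - by move=> x _; rewrite mule_ge0// cylinder_prob_ge0.
  - by apply: emeasurable_funM => //; exact: measurable_cst.
have lim : c%:E + (1 - c)%:E * cylinder_prob kappa n (fun=> ~` A) s
    @[n --> \oo] --> c%:E + (1 - c)%:E * never kappa A s.
  apply: cvgeD; first by rewrite fin_num_adde_defr.
    exact: cvg_cst.
  by apply: cvgeZl => //; exact: cvg_never.
move: lim; rewrite A0 mule0 adde0 => lim.
by apply: (cvge_ge _ lim); apply: nearW => n; exact: bound.
Qed.

Lemma never_le_eq0 C (c : R) : measurable C -> (0 <= c < 1)%R ->
  (forall s, never kappa C s <= c%:E) -> forall s, never kappa C s = 0.
Proof.
move=> mC /andP[c0 c1] Cc s.
have mC' (i : nat) : measurable (~` C) by exact: measurableC.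
have mv n := measurable_cylinder_prob kappa n mC'.
(* A path avoiding [C] forever avoids it up to time n, and from its state at that time avoids it
   with probability at most c. *)
have bound n t : never kappa C t <=
    c%:E * cylinder_prob kappa n (fun=> ~` C) t.
  have [Ct|nCt] := pselect (C t).
    by rewrite never_mem// mule_ge0// cylinder_prob_ge0.
  elim: n t nCt => [|n ih] t nCt.
    by rewrite /= indicE mem_set// !mule1.
  rewrite /= indicE mem_set// mul1e.
  rewrite (le_trans (never_le_integral t mC))//.
  rewrite -ge0_integralZl//; last by move=> x _; exact: cylinder_prob_ge0.
  apply: ge0_le_integral => //.
  - exact: measurable_never.
  - by apply: emeasurable_funM => //; exact: measurable_cst.
  - move=> x _; have [Cx|nCx] := pselect (C x); last exact: ih.
    by rewrite never_mem// mule_ge0// cylinder_prob_ge0.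
have lim : c%:E * cylinder_prob kappa n (fun=> ~` C) s
    @[n --> \oo] --> c%:E * never kappa C s.
  by apply: cvgeZl => //; exact: cvg_never.
have {lim} : never kappa C s <= c%:E * never kappa C s.
  by apply: (cvge_ge _ lim); apply: nearW => n; exact: bound.
have := never_ge0 kappa C s; rewrite -(fineK (fin_num_never kappa s mC)).
set u := fine _; rewrite -EFinM !lee_fin => u0 ucu; congr (_%:E).
apply/eqP; rewrite eq_le u0 andbT.
(* The inequality u <= c u reads (1 - c) u <= 0 with 1 - c > 0. *)
rewrite -(pmulr_rle0 u (_ : 0 < 1 - c)%R) ?subr_gt0//.
by rewrite mulrBl mul1r subr_le0.
Qed.

Lemma finite_attractor_decisive B mu : measurable B ->
  has_finite_attractor kappa ->
  Prob kappa mu (ev_F (B `|` avoid_set kappa B)) = 1.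
Proof.
move=> mB [A finA [mA attrA]]; have mav := measurable_avoid_set kappa mB.
set C := B `|` _; have mC : measurable C by exact: measurableU.
have [|c [c01 Cc]] := @finite_set_lt1 _ _ (never kappa C) _ finA.
  by move=> s; rewrite never_ge0 never_avoid_lt1.
have C0 : forall s, never kappa C s = 0.
  apply: (never_le_eq0 mC c01); apply: (never_le_attractor mA mC) => //.
    by have /andP[-> /ltW] := c01.
  move=> s; apply/probability_setC_eq0; first exact: measurable_ev_F.
  exact: attrA.
apply/probability_setC_eq0; first exact: measurable_ev_F.
by rewrite Prob_never// integral0_eq.
Qed.

End finite_attractor.

(** * Null sets of the n-step laws *)

Section null_sets.
Context d (S : measurableType d) (R : realType) (kappa : R.-pker S ~> S).
Implicit Types (mu : probability S R) (A B : set S).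

(** A nonnegative function with zero integral vanishes almost everywhere. Hence the null sets of
    [omega kappa mu] depend only on those of [mu]. *)
Lemma omega_eq0 mu A : measurable A ->
  omega kappa mu A = 0 <-> mu [set s | kappa s A != 0] = 0.
Proof.
move=> mA; have mk := measurable_kernel kappa A mA.
have mN : measurable [set s | kappa s A != 0].
  by rewrite -[X in measurable X]setTI; exact: emeasurable_neq.
have -> : omega kappa mu A = \int[mu]_s `|kappa s A|.
  by apply: eq_integral => s _; rewrite gee0_abs.
rewrite (ae_eq_integral_abs _ measurableT mk); split=> [[N [mN' N0 hN]]|N0].
  apply: (subset_measure0 mN mN' _ N0) => s /= /eqP k0.
  by apply: hN => /(_ Logic.I).
exists [set s | kappa s A != 0]; split=> // s /= k0.
by apply/eqP => k0'; apply: k0.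
Qed.

Lemma Prob_at_eq i mu B : measurable B ->
  Prob kappa mu [set w : paths S | B (w i)] = iter i (omega kappa) mu B.
Proof.
move=> mB; elim: i mu => [|i ih] mu.
  have -> : [set w : paths S | B (w 0%N)] = cylinder 0 (fun=> B).
    by apply/seteqP; split => w; [move=> Bw [|]|move=> /(_ 0%N); exact].
  rewrite Prob_path_law//=; under eq_integral do rewrite mule1.
  by rewrite integral_indic// setIT.
by rewrite iterSr -ih -Prob_shift//; exact: measurable_at.
Qed.

(** Reachability is a countable union over times, so membership in an avoid-set is a statement about
    null sets of n-step laws. *)
Lemma Prob_ev_F_eq0 mu B : measurable B ->
  Prob kappa mu (ev_F B) = 0 <-> forall i, iter i (omega kappa) mu B = 0.
Proof.
move=> mB.
have FE : ev_F B = \bigcup_i [set w : paths S | B (w i)].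
  by apply/seteqP; split => w [i]; exists i.
split=> [F0 i|h].
  rewrite -Prob_at_eq//; apply: (subset_measure0 _ _ _ F0).
  - exact: measurable_at.
  - exact: measurable_ev_F.
  - by move=> w Bw; exists i.
apply/negligibleP; first exact: measurable_ev_F.
rewrite FE; apply: negligible_bigcup => i.
by apply/negligibleP; [exact: measurable_at|rewrite [LHS]Prob_at_eq].
Qed.

End null_sets.

(** * Transfer along the abstraction *)

Section abstraction.
Context d1 d2 (S1 : measurableType d1) (S2 : measurableType d2) (R : realType).
Variables (kappa1 : R.-pker S1 ~> S1) (kappa2 : R.-pker S2 ~> S2).
Variable alpha : {mfun S1 >-> S2}.
Hypothesis abs : is_abstraction kappa1 kappa2 alpha.

(** The law [nu] need not be the image of [mu]: an abstraction step preserves the correspondence of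
    null sets, not equality of laws. *)
Lemma abstraction_iter (mu : probability S1 R) (nu : probability S2 R) :
  (forall B, measurable B -> mu (alpha @^-1` B) = 0 <-> nu B = 0) ->
  forall i B, measurable B ->
    iter i (omega kappa1) mu (alpha @^-1` B) = 0 <->
    iter i (omega kappa2) nu B = 0.
Proof.
move=> munu; elim=> [|i ih] B mB; first exact: munu.
rewrite /=; set mu' := iter i _ mu in ih *; set nu' := iter i _ nu in ih *.
apply: iff_trans (abs mu' mB) _.
have mN : measurable [set s | kappa2 s B != 0].
  rewrite -[X in measurable X]setTI; apply: emeasurable_neq => //.
  exact: measurable_kernel.
(* The image of [mu'] is exchanged for [nu'] by applying the induction hypothesis to the states from
   which [B] has positive one-step probability. *)
apply: iff_trans (omega_eq0 kappa2 (distribution mu' alpha) mB) _.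
apply: iff_trans (ih _ mN) _.
exact: iff_sym (omega_eq0 kappa2 nu' mB).
Qed.

Lemma avoid_set_preimage B : measurable B ->
  avoid_set kappa1 (alpha @^-1` B) = alpha @^-1` avoid_set kappa2 B.
Proof.
move=> mB.
have mpre (C : set S2) : measurable C -> measurable (alpha @^-1` C).
  by move=> mC; rewrite -[X in measurable X]setTI; exact: measurable_funP.
have av s : avoid_set kappa1 (alpha @^-1` B) s <-> avoid_set kappa2 B (alpha s).
  (* The Dirac measure at [alpha s] is the image of the one at s, so the null sets agree at time
     0. *)
  have it :=
    @abstraction_iter (dirac s) (dirac (alpha s)) (fun _ _ => iff_refl _).
  apply: iff_trans (Prob_ev_F_eq0 _ _ (mpre _ mB)) _.
  apply: iff_trans (iff_sym (Prob_ev_F_eq0 _ _ mB)).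
  by split=> h i; apply/it.
by apply/seteqP; split => s /av.
Qed.

Lemma sound_abstraction_decisive B (mu : probability S1 R) : measurable B ->
  is_sound_abstraction kappa1 kappa2 alpha -> has_finite_attractor kappa2 ->
  Prob kappa1 mu
    (ev_F (alpha @^-1` B) `|` ev_F (avoid_set kappa1 (alpha @^-1` B))) = 1.
Proof.
move=> mB [_ sound] attr; rewrite avoid_set_preimage// -ev_FU -preimage_setU.
apply: sound; last exact: finite_attractor_decisive.
by apply: measurableU => //; exact: measurable_avoid_set.
Qed.

End abstraction.

Theorem proposition35 (R : realType) (d1 d2 : measure_display)
    (S1 : measurableType d1) (S2 : measurableType d2)
    (kappa1 : R.-pker S1 ~> S1) (kappa2 : R.-pker S2 ~> S2)
    (alpha : {mfun S1 >-> S2})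
    (T2_dmc : denumerable_MC kappa2)
    (T2_abs : is_abstraction kappa1 kappa2 alpha) :
  let BB := [set alpha @^-1` B | B in [set: set S2]] in
  [/\ (finite_MC kappa2 -> is_sound_abstraction kappa1 kappa2 alpha ->
        has_finite_attractor kappa2 /\
        is_sound_abstraction kappa1 kappa2 alpha),
      (has_finite_attractor kappa2 ->
        is_sound_abstraction kappa1 kappa2 alpha ->
        strongly_decisive kappa1 BB),
      ((decisive kappa1 BB <-> strongly_decisive kappa1 BB) /\
       (strongly_decisive kappa1 BB <-> persistently_decisive kappa1 BB)) &
      (strongly_decisive kappa1 BB -> fair kappa1 BB)].
Proof.
move=> BB; have [_ mS2] := T2_dmc.
have mBB B : BB B -> measurable B.
  by move=> [C _ <-]; rewrite -[X in measurable X]setTI; exact: measurable_funP.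
have dec_strong : decisive kappa1 BB -> strongly_decisive kappa1 BB.
  move=> /(decisive_persistently_decisive mBB).
  exact: persistently_decisive_strongly_decisive.
split.
- move=> [_ finS2] sound; split=> //.
  (* The whole finite state space is an attractor, visited at time 0. *)
  exists setT => //; split => [|mu]; first exact: measurableT.
  rewrite (_ : ev_F setT = setT) ?probability_setT//.
  by apply/seteqP; split => // w _; exists 0%N.
- move=> attr sound; apply: dec_strong => _ mu [B _ <-].
  exact: (sound_abstraction_decisive T2_abs).
- split; split => //.
  + exact: strongly_decisive_decisive.
  + move=> /(strongly_decisive_decisive mBB).
    exact: decisive_persistently_decisive.
  + exact: persistently_decisive_strongly_decisive.
- exact: strongly_decisive_fair.
Qed.
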